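(* For every $r\in\mathbb{N}$ and every $a\in\mathbb{Z}$ the function $(m_1,\ldots,m_r)\mapsto T_a(m_1,\ldots,m_r)$ is multiplicative.
   Context: For $n\in\mathbb{N}$ and $k\in\mathbb{Z}$, $c_n(k)=\sum_{1\le j\le n,\ \gcd(j,n)=1}\exp(2\pi i jk/n)$ is the Ramanujan sum. For $m_1,\ldots,m_r\in\mathbb{N}$ with $m=\operatorname{lcm}(m_1,\ldots,m_r)$, $T_a(m_1,\ldots,m_r)=\sum c_{m_1}(k_1)\cdots c_{m_{r-1}}(k_{r-1})c_{m_r}(k_1+\cdots+k_{r-1}+\ell-a)$, the sum over $k_1,\ldots,k_{r-1},\ell$ running through residues modulo $m$ with $\gcd(\ell,m)=1$ (for $r=1$ only over $\ell$). A function $f:\mathbb{N}^r\to\mathbb{C}$ is multiplicative if it is not identically zero and $f(m_1n_1,\ldots,m_rn_r)=f(m_1,\ldots,m_r)f(n_1,\ldots,n_r)$ whenever $\gcd(m_1\cdots m_r,n_1\cdots n_r)=1$. *)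

(* Defs.v *)
From HB Require Import structures.
From mathcomp Require Import all_boot all_order all_algebra.
From mathcomp Require Import complex.
From mathcomp Require Import reals sequences trigo.

Set Implicit Arguments.
Unset Strict Implicit.
Unset Printing Implicit Defensive.

Import Order.TTheory GRing.Theory Num.Theory.

Local Open Scope ring_scope.
Local Open Scope complex_scope.

Definition cexp (R : realType) (z : R[i]) : R[i] :=
  let: x +i* y := z in (expR x)%:C * (cos y +i* sin y).

Definition ramanujan_sum (R : realType) (n : nat) (k : int) : R[i] :=
  \sum_(1 <= j < n.+1 | coprime j n)
     cexp (2 * (pi : R)%:C * 'i%C * (j%:Z * k)%:~R / n%:R).

Definition lcm_family (r : nat) (m : 'I_r -> nat) : nat :=
  \big[lcmn/1%N]_(i < r) m i.

(* T_a in r.+1 variables: the last argument is [m ord_max], and the first r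
   are [m (widen_ord (leqnSn r) i)] for [i < r]. The summation variables range
   over the representatives 0, ..., lcm - 1 of the residues modulo the lcm. *)
Definition T_sum (R : realType) (r : nat) (a : int) (m : 'I_r.+1 -> nat) : R[i] :=
  \sum_(k : {ffun 'I_r -> 'I_(lcm_family m)})
   \sum_(l < lcm_family m | coprime l (lcm_family m))
     (\prod_(i < r) ramanujan_sum R (m (widen_ord (leqnSn r) i)) (k i)%:Z)
     * ramanujan_sum R (m ord_max) (\sum_(i < r) (k i)%:Z + l%:Z - a).

(* Arguments range over positive integers, hence the positivity conditions. *)
Definition multiplicative (R : realType) (r : nat) (f : ('I_r -> nat) -> R[i]) : Prop :=
  (exists m : 'I_r -> nat, (forall i, (0 < m i)%N) /\ f m <> 0) /\
  (forall m n : 'I_r -> nat,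
     (forall i, (0 < m i)%N) -> (forall i, (0 < n i)%N) ->
     coprime (\prod_(i < r) m i)%N (\prod_(i < r) n i)%N ->
     f (fun i => (m i * n i)%N) = f m * f n).

(* Main.v *)
(** Since [x |-> e(x/n)] is an additive character, the Chinese remainder
    bijection [(i, j) |-> i n + j m mod mn] splits [c_mn(k)] as [c_m(k) c_n(k)]
    for coprime [m] and [n]. As [c_n(k)] depends only on [k] modulo [n], every
    factor in the summand of [T_a(m_1 n_1, ..., m_r n_r)] splits into a function
    of the residues modulo [M = lcm m_i] and one of the residues modulo
    [N = lcm n_i]. The moduli [M] and [N] are coprime, so by the Chinese
    remainder theorem the sum over residues modulo [MN] is a product. *)

From Pilot Require Import Defs.
From mathcomp Require Import all_boot all_order all_algebra.
From mathcomp Require Import complex reals.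
From mathcomp Require Import exp trigo ring.

Set Implicit Arguments.
Unset Strict Implicit.
Unset Printing Implicit Defensive.

Import Order.TTheory GRing.Theory Num.Theory.
(* [GRing.Theory] shadows [multiplicative]. *)
Import Pilot.Defs.

Local Open Scope ring_scope.
Local Open Scope complex_scope.

(** * The additive character e(x/n) *)

Section AdditiveCharacter.
Variable R : realType.

(** Shaped so that the terms of [ramanujan_sum] are [unit_exp n (j * k)] by conversion. *)
Definition unit_exp (n : nat) (x : int) : R[i] :=
  cexp (2 * (pi : R)%:C * 'i%C * x%:~R / n%:R).

Lemma unit_expE n x :
  unit_exp n x = cos (2 * pi * x%:~R / n%:R : R) +i* sin (2 * pi * x%:~R / n%:R : R).
Proof.
have -> : unit_exp n x = cexp (0 +i* (2 * pi * x%:~R / n%:R : R)).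
  rewrite /unit_exp; congr cexp.
  have -> : (2 : R[i]) = (2 : R)%:C by rewrite rmorph_nat.
  have -> : (x%:~R : R[i]) = (x%:~R : R)%:C by rewrite rmorph_int.
  have -> : (n%:R : R[i]) = (n%:R : R)%:C by rewrite rmorph_nat.
  rewrite -fmorphV.
  by apply/eqP; rewrite eq_complex /=; apply/andP; split; apply/eqP; ring.
by rewrite /cexp expR0 mul1r.
Qed.

Lemma unit_expD n x y : unit_exp n (x + y) = unit_exp n x * unit_exp n y.
Proof.
rewrite !unit_expE rmorphD /= mulrDr mulrDl cosD sinD.
by apply/eqP; rewrite eq_complex /=; apply/andP; split; apply/eqP; ring.
Qed.

Lemma unit_exp0 n : unit_exp n 0 = 1.
Proof. by rewrite unit_expE mulr0 mul0r cos0 sin0. Qed.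

Lemma unit_exp_scale m n (x : int) : (0 < m)%N -> unit_exp (m * n) (m%:Z * x) = unit_exp n x.
Proof.
move=> m_gt0; rewrite !unit_expE.
have m_neq0 : m%:R != 0 :> R by rewrite pnatr_eq0 -lt0n.
have -> // : 2 * pi * (m%:Z * x)%:~R / (m * n)%:R = 2 * pi * x%:~R / n%:R :> R.
(* For [n = 0] both quotients vanish, as division by 0 yields 0. *)
have [->|n_gt0] := posnP n; first by rewrite muln0 invr0 !mulr0.
have n_neq0 : n%:R != 0 :> R by rewrite pnatr_eq0 -lt0n.
by rewrite natrM rmorphM /=; field; rewrite n_neq0.
Qed.

Lemma unit_exp_period n (x : int) : (0 < n)%N -> unit_exp n (n%:Z * x) = 1.
Proof.
move=> n_gt0; rewrite -[n in unit_exp n]muln1 unit_exp_scale //.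
have unit_exp1 (k : nat) : unit_exp 1 k = 1.
  elim: k => [|k IHk]; first exact: unit_exp0.
  rewrite -[k.+1]addn1 PoszD unit_expD IHk mul1r unit_expE invr1 !mulr1.
  by rewrite mulr_natl cos2pi sin2pi.
case: x => k; first exact: unit_exp1.
(* For a negative integer, multiply by the value at its opposite, which is 1. *)
apply: (mulIf (x := unit_exp 1 k.+1)); first by rewrite unit_exp1 oner_eq0.
by rewrite -unit_expD NegzE addNr unit_exp0 unit_exp1 mulr1.
Qed.

Lemma unit_exp_mod n x y : (0 < n)%N -> (x = y %[mod n])%Z ->
  unit_exp n x = unit_exp n y.
Proof.
move=> n_gt0 /eqP; rewrite eqz_mod_dvd => /dvdzP[q xy].
by rewrite -(subrK y x) unit_expD xy mulrC [q * _]mulrC unit_exp_period ?mulr1.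
Qed.

End AdditiveCharacter.

Lemma eqn_modMr d p m n : coprime d p ->
  (m * p == n * p %[mod d])%N = (m == n %[mod d])%N.
Proof.
(* [eqn_mod_dvd] subtracts natural numbers, so the two must be ordered first. *)
move=> co_dp; wlog le_nm : m n / (n <= m)%N => [hwlog|].
  by have [/hwlog//|/ltnW/hwlog] := leqP n m; rewrite eq_sym => ->; rewrite eq_sym.
by rewrite !eqn_mod_dvd ?leq_mul2r ?le_nm ?orbT // -mulnBl Gauss_dvdl.
Qed.

(** * Ramanujan sums: periodicity and multiplicativity *)

Section RamanujanSum.
Variable R : realType.
Local Notation unit_exp := (@unit_exp R).

(* The representative [n] of the zero residue is replaced by [0]. *)
Lemma ramanujan_sumE n k : (0 < n)%N ->
  ramanujan_sum R n k = \sum_(j < n | coprime j n) unit_exp n (j%:Z * k).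
Proof.
move=> n_gt0; rewrite /ramanujan_sum big_mkcond big_nat_recr //= -big_mkcond.
rewrite -(big_mkord (fun j => coprime j n) (fun j => unit_exp n (j%:Z * k))).
rewrite [RHS]big_mkcond big_ltn //= -[in RHS]big_mkcond addrC.
congr (_ + _); rewrite /coprime gcdnn gcd0n; case: ifP => // _.
by rewrite mul0r unit_exp0; apply: unit_exp_period.
Qed.

Lemma ramanujan_sum_mod n k k' : (0 < n)%N -> (k = k' %[mod n])%Z ->
  ramanujan_sum R n k = ramanujan_sum R n k'.
Proof.
move=> n_gt0 kk'; rewrite !ramanujan_sumE //; apply: eq_bigr => j _.
by apply: unit_exp_mod => //; rewrite -modzMmr kk' modzMmr.
Qed.

Lemma ramanujan_sum1 k : ramanujan_sum R 1 k = 1.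
Proof. by rewrite ramanujan_sumE // big_mkcond big_ord1 /= mul0r unit_exp0. Qed.

Lemma ramanujan_sumM m n k : (0 < m)%N -> (0 < n)%N -> coprime m n ->
  ramanujan_sum R (m * n) k = ramanujan_sum R m k * ramanujan_sum R n k.
Proof.
move=> m_gt0 n_gt0 co_mn.
have mn_gt0 : (0 < m * n)%N by rewrite muln_gt0 m_gt0.
rewrite !ramanujan_sumE // big_distrlr /= pair_big /=.
pose h (p : 'I_m * 'I_n) : 'I_(m * n) :=
  Ordinal (ltn_pmod (p.1 * n + p.2 * m) mn_gt0).
have h_inj : injective h.
  (* Modulo [m] only [i * n] survives, and [n] is invertible there; likewise for [j * m] modulo
     [n]. *)
  move=> [i j] [i' j'] /(congr1 val) /= /eqP.
  rewrite chinese_remainder // => /andP[].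
  rewrite ![(_ * n + _ * m)%N]addnC.
  rewrite !modnMDl ![(_ * m + _ * n)%N]addnC !modnMDl.
  rewrite !eqn_modMr ?[coprime n m]coprime_sym //.
  by rewrite !modn_small // => /eqP/val_inj-> /eqP/val_inj->.
have h_bij : bijective h by apply: inj_card_bij h_inj _; rewrite card_prod !card_ord.
rewrite (reindex h) /=; last exact: onW_bij.
apply: eq_big => [[i j]|[i j] _] /=.
  (* [i * n + j * m] is coprime to [m] exactly when [i] is, and to [n] exactly when [j] is. *)
  rewrite coprime_modl coprimeMr /=.
  rewrite -[coprime _ m]coprime_modl -[coprime _ n]coprime_modl.
  rewrite modnMDl [(_ * n + _ * m)%N]addnC modnMDl !coprime_modl !coprimeMl.
  by rewrite co_mn [coprime n m]coprime_sym co_mn !andbT.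
rewrite (@unit_exp_mod _ _ _ (n%:Z * (i%:Z * k) + m%:Z * (j%:Z * k))) //.
  by rewrite unit_expD unit_exp_scale // [(m * n)%N]mulnC unit_exp_scale.
rewrite -modz_nat modzMml; congr modz; rewrite PoszD !PoszM; ring.
Qed.

End RamanujanSum.

(** * Least common multiples of families *)

Section LcmFamily.

Lemma dvdn_lcm_family r (m : 'I_r -> nat) i : (m i %| lcm_family m)%N.
Proof. by rewrite /lcm_family (bigD1 i) //= dvdn_lcml. Qed.

Lemma lcm_family_gt0 r (m : 'I_r -> nat) :
  (forall i, 0 < m i)%N -> (0 < lcm_family m)%N.
Proof.
move=> m_gt0; rewrite /lcm_family; elim/big_ind: _ => // x y x0 y0.
by rewrite lcmn_gt0 x0.
Qed.

(** Carries coprimality from the products in [multiplicative] over to the lcms. *)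
Lemma lcm_family_dvd_prod r (m : 'I_r -> nat) :
  (lcm_family m %| \prod_(i < r) m i)%N.
Proof.
rewrite /lcm_family; elim/big_ind2: _ => // x1 x2 y1 y2 d1 d2.
by rewrite dvdn_lcm dvdn_mulr // dvdn_mull.
Qed.

(** Each [m i * n i] divides the right side. Conversely, both lcms divide the left side, and since
    they are coprime, so does their product. *)
Lemma lcm_familyM r (m n : 'I_r -> nat) : coprime (lcm_family m) (lcm_family n) ->
  lcm_family (fun i => m i * n i)%N = (lcm_family m * lcm_family n)%N.
Proof.
move=> co_MN; apply/eqP; rewrite eqn_dvd; apply/andP; split.
  rewrite {1}/lcm_family; elim/big_ind: _ => //.
    by move=> x y dx dy; rewrite dvdn_lcm dx.
  by move=> i _; rewrite dvdn_mul ?dvdn_lcm_family.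
have dvd_lcm (p : 'I_r -> nat) d : (forall i, p i %| d)%N -> (lcm_family p %| d)%N.
  move=> dp; rewrite /lcm_family; elim/big_ind: _ => // x y dx dy.
  by rewrite dvdn_lcm dx.
rewrite Gauss_dvd //; apply/andP; split; apply: dvd_lcm => i;
  apply: dvdn_trans (dvdn_lcm_family _ i).
  exact: dvdn_mulr.
exact: dvdn_mull.
Qed.

End LcmFamily.

(** * Splitting sums over residues modulo [M * N] *)

Section ChineseRemainder.
Variables (M N : nat).
Hypotheses (M_gt0 : (0 < M)%N) (N_gt0 : (0 < N)%N) (co_MN : coprime M N).

Definition residue_pair (x : 'I_(M * N)) : 'I_M * 'I_N :=
  (Ordinal (ltn_pmod x M_gt0), Ordinal (ltn_pmod x N_gt0)).

Lemma residue_pair_bij : bijective residue_pair.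
Proof.
apply: inj_card_bij => [x y [eqM eqN]|]; last by rewrite card_prod !card_ord.
apply: val_inj => /=.
rewrite -(modn_small (ltn_ord x)) -(modn_small (ltn_ord y)).
by apply/eqP; rewrite chinese_remainder // eqM eqN !eqxx.
Qed.

(** A residue is coprime to [M * N] exactly when its reductions are coprime to [M] and [N]
    respectively. *)
Lemma sum_coprime_residue_pair (S : comPzRingType) (F : 'I_M -> S) (G : 'I_N -> S) :
  \sum_(x < M * N | coprime x (M * N)) F (residue_pair x).1 * G (residue_pair x).2 =
  (\sum_(x < M | coprime x M) F x) * (\sum_(y < N | coprime y N) G y).
Proof.
rewrite big_distrlr pair_big /= [RHS](reindex residue_pair) /=; last first.
  exact/onW_bij/residue_pair_bij.
by apply: eq_bigl => x; rewrite /= !coprime_modl coprimeMr.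
Qed.

(** The Chinese remainder bijection acts on each coordinate of a tuple separately. *)
Lemma sum_ffun_residue_pair (S : comPzRingType) (I : finType)
    (F : {ffun I -> 'I_M} -> S) (G : {ffun I -> 'I_N} -> S) :
  \sum_(k : {ffun I -> 'I_(M * N)})
     F [ffun i => (residue_pair (k i)).1] * G [ffun i => (residue_pair (k i)).2] =
  (\sum_k F k) * (\sum_k G k).
Proof.
rewrite big_distrlr pair_big /=.
have [g gK Kg] := residue_pair_bij.
pose h (k : {ffun I -> 'I_(M * N)}) :=
  ([ffun i => (residue_pair (k i)).1], [ffun i => (residue_pair (k i)).2]).
rewrite [RHS](reindex h) //; apply: onW_bij.
exists (fun p : {ffun I -> 'I_M} * {ffun I -> 'I_N} => [ffun i => g (p.1 i, p.2 i)]).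
  by move=> k; apply/ffunP => i; rewrite !ffunE -surjective_pairing gK.
by case=> k k'; congr (_, _); apply/ffunP => i; rewrite !ffunE Kg.
Qed.

End ChineseRemainder.

(** * Factorization of T_a *)

Section TSum.
Variable R : realType.

(* Freeing the modulus [L] from its definition as an lcm allows it to be
   rewritten, although the types of the summation variables depend on it. *)
Definition T_summand r (a : int) (m : 'I_r.+1 -> nat) L
    (k : {ffun 'I_r -> 'I_L}) (l : 'I_L) : R[i] :=
  (\prod_(i < r) ramanujan_sum R (m (widen_ord (leqnSn r) i)) (k i)%:Z)
  * ramanujan_sum R (m ord_max) (\sum_(i < r) (k i)%:Z + l%:Z - a).

Definition T_sum_mod r (a : int) (m : 'I_r.+1 -> nat) L : R[i] :=
  \sum_(k : {ffun 'I_r -> 'I_L}) \sum_(l < L | coprime l L) T_summand a m k l.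

Lemma T_sumE r a (m : 'I_r.+1 -> nat) :
  T_sum R a m = T_sum_mod a m (lcm_family m).
Proof. by []. Qed.

(** Serves to reduce residues modulo [L = M * N] to residues modulo [L' = M] or [L' = N]. Congruence
    modulo [L'] implies congruence modulo each [m i], which is a period of its Ramanujan sum. *)
Lemma T_summand_mod r a (m : 'I_r.+1 -> nat) L L'
    (k : {ffun 'I_r -> 'I_L}) (l : 'I_L) (k' : {ffun 'I_r -> 'I_L'}) (l' : 'I_L') :
  (forall i, 0 < m i)%N -> (forall i, m i %| L')%N ->
  (forall i, k i = k' i %[mod L']) -> l = l' %[mod L'] ->
  T_summand a m k l = T_summand a m k' l'.
Proof.
move=> m_gt0 mL kk' ll'.
have dvdB i (x y : nat) : x = y %[mod L'] -> (m i %| x%:Z - y%:Z)%Z.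
  move=> xy; apply: (@dvdz_trans L'); first exact: mL.
  by rewrite -eqz_mod_dvd !modz_nat xy.
rewrite /T_summand; congr (_ * _).
  apply: eq_bigr => i _; apply: ramanujan_sum_mod => //.
  by apply/eqP; rewrite eqz_mod_dvd; apply: dvdB.
apply: ramanujan_sum_mod => //; apply/eqP; rewrite eqz_mod_dvd.
set s := \sum_i _; set s' := \sum_i _.
have -> : s + l%:Z - a - (s' + l'%:Z - a) = (s - s') + (l%:Z - l'%:Z) by ring.
rewrite rpredD ?dvdB // /s /s' -sumrB.
by apply: rpred_sum => i _; apply: dvdB.
Qed.

Lemma T_summandM r a (m n : 'I_r.+1 -> nat) L (k : {ffun 'I_r -> 'I_L}) (l : 'I_L) :
  (forall i, 0 < m i)%N -> (forall i, 0 < n i)%N -> (forall i, coprime (m i) (n i)) ->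
  T_summand a (fun i => m i * n i)%N k l = T_summand a m k l * T_summand a n k l.
Proof.
move=> m_gt0 n_gt0 co_mn; rewrite /T_summand ramanujan_sumM //.
under eq_bigr => i _ do rewrite ramanujan_sumM //.
by rewrite big_split /= mulrACA.
Qed.

Lemma T_sum_modM r a (m n : 'I_r.+1 -> nat) M N :
  (forall i, 0 < m i)%N -> (forall i, 0 < n i)%N -> (0 < M)%N -> (0 < N)%N ->
  coprime M N -> (forall i, m i %| M)%N -> (forall i, n i %| N)%N ->
  T_sum_mod a (fun i => m i * n i)%N (M * N) = T_sum_mod a m M * T_sum_mod a n N.
Proof.
move=> m_gt0 n_gt0 M_gt0 N_gt0 co_MN mM nN.
have co_mn i : coprime (m i) (n i).
  exact: coprime_dvdl (mM i) (coprime_dvdr (nN i) co_MN).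
rewrite /T_sum_mod -(sum_ffun_residue_pair M_gt0 N_gt0 co_MN).
apply: eq_bigr => k _; rewrite -(sum_coprime_residue_pair M_gt0 N_gt0 co_MN).
apply: eq_bigr => l _; rewrite T_summandM //.
by congr (_ * _); apply: T_summand_mod => // [i|]; rewrite ?ffunE /= modn_mod.
Qed.

End TSum.

(* T_a as a function of r.+1 variables, so that the number of variables ranges
   over all positive integers *)
Theorem corollary15 (R : realType) (r : nat) (a : int) :
  @multiplicative R r.+1 (fun m : 'I_r.+1 -> nat => @T_sum R r a m).
Proof.
split=> [|m n m_gt0 n_gt0 co_prod].
  (* At (1, ..., 1) the only residue is 0 and every factor is c_1 = 1, so T_a = 1. *)
  exists (fun=> 1%N); split=> //.
  have L1 : lcm_family (fun _ : 'I_r.+1 => 1%N) = 1%N.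
    by apply/eqP; rewrite -dvdn1; apply: dvdn_trans (lcm_family_dvd_prod _) _; rewrite big1.
  rewrite T_sumE L1 /T_sum_mod.
  under eq_bigr => k _.
    rewrite big_mkcond big_ord1 /= /T_summand ramanujan_sum1 mulr1.
    under eq_bigr => i _ do rewrite ramanujan_sum1.
    rewrite big1_eq; over.
  by rewrite sumr_const card_ffun !card_ord exp1n mulr1n; apply/eqP; exact: oner_neq0.
have co_MN : coprime (lcm_family m) (lcm_family n).
  apply: coprime_dvdl (lcm_family_dvd_prod m) _.
  exact: coprime_dvdr (lcm_family_dvd_prod n) co_prod.
rewrite !T_sumE lcm_familyM //.
by rewrite T_sum_modM ?lcm_family_gt0 // => i; exact: dvdn_lcm_family.
Qed.
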